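(* Let $k\ge 3$, let $\mathbf{n}=(n_1,\dots,n_k)\in\mathbb{Z}_{>0}^k$ and assume $n_1\ge n_2\ge\dots\ge n_k$. (a) If $n_2\le (k-2)n_k$, then $\mathbf{n}$ is a lonely runner instance. (b) If $n_3\le (k-2)n_k$ and $n_2\ge k n_3$, then $\mathbf{n}$ is a lonely runner instance.
   Context: A vector $\mathbf{n}\in\mathbb{Z}_{>0}^k$ is a lonely runner instance if there exists a real number $t$ such that for all $1\le j\le k$ the distance of $tn_j$ to the nearest integer is at least $\frac{1}{k+1}$. *)

(* Defs.v *)
From HB Require Import structures.
From mathcomp Require Import all_boot all_order all_algebra.
From mathcomp Require Import boolp classical_sets reals.
Set Implicit Arguments.
Unset Strict Implicit.
Unset Printing Implicit Defensive.
Import Order.TTheory GRing.Theory Num.Theory.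
Local Open Scope classical_set_scope.
Local Open Scope ring_scope.

(* Distance from x to the nearest integer; the set is nonempty and bounded
   below by 0, so inf takes no default value here. *)
Definition dist_int (R : realType) (x : R) : R :=
  inf [set `|x - m%:~R| | m in [set: int]].

(* Positivity of the entries of n is not part of this predicate: it has to be
   assumed separately wherever vectors of positive integers are meant. *)
Definition lonely_runner_instance (R : realType) (k : nat) (n : k.-tuple nat) : Prop :=
  exists t : R, forall j : 'I_k, k.+1%:R^-1 <= dist_int (t * (tnth n j)%:R).

(* Main.v *)
Require Import Defs.
From mathcomp Require Import all_boot all_order all_algebra.
From mathcomp Require Import reals.
From mathcomp Require Import classical_sets lra.

(* Put [c = 1/(k+1)].  While [c / m <= t <= (1 - c) / M], every runner with speed
   in [m, M] has its position in [c, 1 - c].  If [M <= (k - 2) m], this window of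
   times has length at least [2 c / M].  In (a) the remaining runner is at least
   as fast as [M], so it travels at least [2 c] during the window and cannot stay
   in an open arc of length [2 c].  In (b) the second fastest runner travels at
   least [2 k c = 2 - 2 c] during the window, hence crosses a whole arc
   [p + c, p + 1 - c]; meanwhile the fastest one travels at least
   [1 - 2 c >= 2 c]. *)

Import Order.TTheory GRing.Theory Num.Theory.

Section DistInt.
Local Open Scope ring_scope.
Context {R : realType}.
Implicit Types (a b c x v s e t : R).

(** Every integer is at most [p] or at least [p + 1], so [c] is a lower bound of the set whose
    infimum is taken. *)
Lemma le_dist_int c x (p : int) :
  p%:~R + c <= x -> x <= p%:~R + 1 - c -> c <= dist_int x.
Proof.
move=> lx xu; apply: lb_le_inf; first by exists `|x - 0%:~R|, 0.
move=> _ [q _ <-]; have [qp|pq] := leP q p.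
  have : q%:~R <= p%:~R :> R by rewrite ler_int.
  by move=> ?; rewrite (le_trans _ (ler_norm _)) //; lra.
have : (p + 1)%:~R <= q%:~R :> R by rewrite ler_int lezD1.
by rewrite intrD => ?; rewrite distrC (le_trans _ (ler_norm _)) //; lra.
Qed.

Lemma exists_le_dist_int {c a b} : 0 <= c -> c + c <= 1 -> a + (c + c) <= b ->
  exists2 x, a <= x <= b & c <= dist_int x.
Proof.
move=> c0 c1 ab; have := Num.Theory.floor_le (a + c); have := Num.Theory.floorD1_gt (a + c).
(* Now [p - c <= a < p + 1 - c]: either [a] itself is good, or [a < p + c] and the point [p + c] is
   at most [2 c] beyond [a]. *)
set p := Num.floor _; rewrite intrD => up lp.
have [pa|ap] := leP (p%:~R + c) a.
- exists a; last by apply: (@le_dist_int _ _ p) => //; lra.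
  by apply/andP; split; lra.
exists (p%:~R + c); last by apply: (@le_dist_int _ _ p) => //; lra.
by apply/andP; split; lra.
Qed.

(** The first arc starting at or after [a] starts less than 1 later and has length [1 - 2 c]. *)
Lemma exists_arc {c a b} : a + (2 - 2 * c) <= b ->
  exists p : int, a <= p%:~R + c /\ p%:~R + 1 - c <= b.
Proof.
move=> ab; have := ceil_ge (a - c); have := ceilB1_lt (a - c).
rewrite intrB => up lp.
by exists (Num.ceil (a - c)); split; lra.
Qed.

Lemma exists_time {c v s e} : 0 < v -> 0 <= c -> c + c <= 1 -> c + c <= (e - s) * v ->
  exists2 t, s <= t <= e & c <= dist_int (t * v).
Proof.
move=> v0 c0 c1 len.
have [|x /andP[sx xe] cx] := @exists_le_dist_int c (s * v) (e * v) c0 c1; first lra.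
exists (x / v); last by rewrite divfK ?gt_eqF.
by rewrite ler_pdivlMr // ler_pdivrMr // sx xe.
Qed.

(** The exact length of the new window is kept, so that the distance a faster runner covers in it
    can be bounded below. *)
Lemma exists_window {c v s e} : 0 < v -> 2 - 2 * c <= (e - s) * v ->
  exists s' e', [/\ s <= s', e' <= e, (e' - s') * v = 1 - 2 * c
    & forall t, s' <= t <= e' -> c <= dist_int (t * v)].
Proof.
move=> v0 len.
have [|p [sp pe]] := @exists_arc c (s * v) (e * v); first lra.
exists ((p%:~R + c) / v), ((p%:~R + 1 - c) / v); split.
- by rewrite ler_pdivlMr.
- by rewrite ler_pdivrMr.
- by rewrite mulrBl !divfK ?gt_eqF //; lra.
move=> t; rewrite ler_pdivlMr // ler_pdivrMr // => /andP[].
exact: le_dist_int.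
Qed.

Lemma slow_le_dist_int {c m M v t} : 0 < m -> m <= v -> v <= M ->
  0 <= c -> c / m <= t <= (1 - c) / M -> c <= dist_int (t * v).
Proof.
move=> m0 mv vM c0 /andP[].
have v0 := lt_le_trans m0 mv; have M0 := lt_le_trans v0 vM.
rewrite ler_pdivrMr // ler_pdivlMr // => ct tc.
have t0 : 0 <= t by rewrite -(pmulr_lge0 _ m0) (le_trans c0).
apply: (@le_dist_int _ _ 0).
  by rewrite add0r (le_trans ct) // ler_wpM2l.
by rewrite add0r (le_trans _ tc) // ler_wpM2l.
Qed.

Lemma invSn_mulD (k : nat) : k.+1%:R^-1 * k%:R + k.+1%:R^-1 = 1 :> R.
Proof. by rewrite -[X in _ + X]mulr1 -mulrDr -mulrSr mulVf ?pnatr_eq0. Qed.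

(** The right-hand side equals [1 - c - c (M / m)], and [c (M / m) <= c (k - 2) = 1 - 3 c] because
    [c k = 1 - c]. *)
Lemma slow_window_length (k m M : nat) (c := k.+1%:R^-1 : R) :
  (2 <= k)%N -> (0 < m)%N -> (0 < M)%N -> (M <= (k - 2) * m)%N ->
  c + c <= ((1 - c) / M%:R - c / m%:R) * M%:R.
Proof.
move=> k2 m0 M0; rewrite -(ler_nat R) natrM natrB // => Mm.
have m0' : 0 < m%:R :> R by rewrite ltr0n.
have M0' : 0 < M%:R :> R by rewrite ltr0n.
have c0 : 0 < c by rewrite invr_gt0.
have ck : c * k%:R + c = 1 := invSn_mulD k.
rewrite mulrBl divfK ?gt_eqF // mulrAC -mulrA.
have : c * (M%:R / m%:R) <= c * (k%:R - 2).
  by apply: ler_wpM2l (ltW c0) _ _ _; rewrite ler_pdivrMr.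
rewrite mulrBr; lra.
Qed.

End DistInt.

Theorem theorem7 (R : realType) (k : nat) (n : k.-tuple nat)
    (k_ge3 : 3 <= k)
    (n_gt0 : forall j : 'I_k, 0 < tnth n j)
    (n_sorted : sorted geq n) :
  (nth 0 n 1 <= (k - 2) * nth 0 n k.-1 ->
    lonely_runner_instance R n)
  /\
  (nth 0 n 2 <= (k - 2) * nth 0 n k.-1 ->
   k * nth 0 n 2 <= nth 0 n 1 ->
    lonely_runner_instance R n).
Proof.
have nth_le i j : i <= j -> j < k -> nth 0 n j <= nth 0 n i.
  have geq_trans : transitive geq by move=> b a c ab bc; apply: leq_trans bc ab.
  move=> ij jk; apply: (sorted_leq_nth geq_trans leqnn 0 n_sorted) => //;
    by rewrite inE size_tuple // (leq_ltn_trans ij).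
have nth_gt0 i : i < k -> 0 < nth 0 n i.
  by move=> ik; have := n_gt0 (Ordinal ik); rewrite (tnth_nth 0).
have k_gt0 : 0 < k by apply: leq_trans k_ge3.
have last_lt : k.-1 < k by rewrite prednK.
set m := nth 0 n k.-1; have m0 : 0 < m by apply: nth_gt0.
have Rgt0 v : 0 < v -> (0 < v%:R :> R)%R by rewrite ltr0n.
set c : R := (k.+1%:R^-1)%R.
have c0 : (0 < c)%R by rewrite invr_gt0.
have ck : (c * k%:R + c = 1)%R := invSn_mulD k.
(* Together with [ck] this gives [4 c <= 1], hence [c + c <= 1] and, for (b), [c + c <= 1 - 2 c]. *)
have c3 : (c * 3 <= c * k%:R)%R by apply: ler_wpM2l (ltW c0) _ _ _; rewrite ler_nat.
have c_half : (c + c <= 1)%R by lra.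
(* Indices start at 0: (a) uses this with [i = 1], (b) with [i = 2]. *)
have slow i (j : 'I_k) t : i <= j ->
    (c / m%:R <= t <= (1 - c) / (nth 0 n i)%:R)%R ->
    (c <= dist_int (t * (tnth n j)%:R))%R.
  move=> ij; apply: slow_le_dist_int (Rgt0 _ m0) _ _ (ltW c0);
    rewrite (tnth_nth 0) ler_nat.
    by apply: nth_le => //; rewrite -ltnS prednK.
  exact: nth_le.
have length i : i < k -> nth 0 n i <= (k - 2) * m ->
    (c + c <= ((1 - c) / (nth 0 n i)%:R - c / m%:R) * (nth 0 n i)%:R)%R.
  by move=> ik; apply: slow_window_length; rewrite ?nth_gt0 // ltnW.
have k1 : 1 < k by apply: leq_trans k_ge3.
have n10 : ((nth 0 n 1)%:R <= (nth 0 n 0)%:R :> R)%R by rewrite ler_nat nth_le.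
split=> [n1m | n2m n21].
- have len := length 1 k1 n1m; set w := (_ - _)%R in len.
  (* The sign of [w] allows the speed in [len] to be replaced by a larger one. *)
  have w0 : (0 <= w)%R.
    by rewrite -(pmulr_lge0 _ (Rgt0 _ (nth_gt0 1 k1))); lra.
  have [|t tw t0] := @exists_time R c _ (c / m%:R)%R
      ((1 - c) / (nth 0 n 1)%:R)%R (Rgt0 _ (nth_gt0 0 k_gt0)) (ltW c0) c_half.
    by apply: le_trans len _; rewrite ler_wpM2l.
  exists t => j; have [j0|j1] := posnP j; first by rewrite (tnth_nth 0) j0.
  exact: (slow 1).
have len := length 2 k_ge3 n2m; set w := (_ - _)%R in len.
have w0 : (0 <= w)%R.
  by rewrite -(pmulr_lge0 _ (Rgt0 _ (nth_gt0 2 k_ge3))); lra.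
have v1 := Rgt0 _ (nth_gt0 1 k1).
have [|s [e [ws ew len1 t1]]] := @exists_window R c _ (c / m%:R)%R
    ((1 - c) / (nth 0 n 2)%:R)%R v1.
  have n21R : (k%:R * (nth 0 n 2)%:R <= (nth 0 n 1)%:R :> R)%R.
    by rewrite -natrM ler_nat.
  (* Chain: [w * n_2 >= w * k * n_3 >= k (c + c) = 2 - 2 c], with the speeds numbered from 1. *)
  have := ler_wpM2l w0 n21R; rewrite mulrCA -/w.
  have := ler_wpM2l (ler0n R k) len; rewrite mulrDr (mulrC _ c); lra.
have es : (0 <= e - s)%R by rewrite -(pmulr_lge0 _ v1) len1; lra.
have [|t tw t0] := @exists_time R c _ s e (Rgt0 _ (nth_gt0 0 k_gt0)) (ltW c0) c_half.
  by apply: le_trans (ler_wpM2l es n10); rewrite len1; lra.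
exists t => j; have [j0|j1] := posnP j; first by rewrite (tnth_nth 0) j0.
have [j2|j2] := ltnP 1 j.
  apply: (slow 2) => //; case/andP: tw => st te.
  by rewrite (le_trans ws) // (le_trans te).
have -> : tnth n j = nth 0 n 1 by rewrite (tnth_nth 0); congr nth; apply/anti_leq/andP.
exact: t1.
Qed.
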